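(* Let $\Pi$ be an orientable no-fold product structure, even or odd, of type $(m,n)$ with $m,n\ge 2$. Then $\operatorname{girth}(L_1)\ge 6$ if and only if $|A_s\cap A_t|+|B_s\cap B_t|\le 1$ for all distinct signed colors $s\ne t$. When this holds, $L_1$ is the Levi (incidence) graph of a partial linear space with point set $A\sqcup B$, line set the set of signed colors, and incidence $v\in A_s\cup B_s$; the rectangles $A_s\times B_s$, indexed by the signed colors $s$, partition $(A\times B)\setminus D$; and: (i) for each $a\in A$, $\sum_{s\in\Sigma(a)}|B_s|=n-\mathbf 1_{a\in D_A}$, and for each $b\in B$, $\sum_{s\in\Sigma(b)}|A_s|=m-\mathbf 1_{b\in D_B}$; (ii) for distinct signed colors $s\ne t$, $|A_s\cap A_t|+|B_s\cap B_t|\le 1$; (iii) for each color $c$, $|A_{(c,\mathrm{out})}|=|A_{(c,\mathrm{in})}|=x_c$ and $|B_{(c,\mathrm{out})}|=|B_{(c,\mathrm{in})}|=y_c$; (iv) $\sum_s|A_s||B_s|=mn-\delta$, that is $2\sum_c x_cy_c=mn-\delta$; (v) $x_c\le\lfloor\frac{m+1}2\rfloor$ and $y_c\le\lfloor\frac{n+1}2\rfloor$ for each color $c$; (vi) $y_c(m-x_c)\le 2e_A-x_c+\delta$ and $x_c(n-y_c)\le 2e_B-y_c+\delta$ for each color $c$; (vii) $\sum_c x_c(x_c-1)\le\binom m2$ and $\sum_c y_c(y_c-1)\le\binom n2$; (viii) $\sum_{a\in A}\binom{\deg_{L_A}(a)}2+\sum_{b\in B}\binom{\deg_{L_B}(b)}2\le\binom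 r2$, where $r$ is the number of signed colors.
   Context: A product structure of type $(m,n)$ is a triple $\Pi=(A,B,P)$ with $A,B$ finite (disjoint) sets, $|A|=m$, $|B|=n$, and $P$ a partition of $A\times B$ into cells such that if two distinct positions $(a,b),(a',b')$ lie in the same cell then $a\ne a'$ and $b\ne b'$. It is even if every cell has size $2$, and odd if exactly one cell $\{(a_0,b_0)\}$ has size $1$ and all others have size $2$. In the even case put $\delta=0$, $D=D_A=D_B=\varnothing$; in the odd case $\delta=1$, $D=\{(a_0,b_0)\}$, $D_A=\{a_0\}$, $D_B=\{b_0\}$. Horizontal graphs: $L_A$ is the simple graph on $A$ in which $\{a,a'\}$ is an edge iff there are $b,b'\in B$ with $\{(a,b),(a',b')\}\in P$; $L_B$ is the simple graph on $B$ in which $\{b,b'\}$ is an edge iff there are $a,a'\in A$ with $\{(a,b),(a',b')\}\in P$. Colors are the classes of the equivalence relation on $E(L_A)\sqcup E(L_B)$ generated by declaring, for each 2-cell $\{(a,b),(a',b')\}$, the edge $\{a,a'\}$ equivalent to the edge $\{b,b'\}$. Let $x_c$, $y_c$ be the numbers of edges of color $c$ in $L_A$, $L_B$, and $e_A=|E(L_A)|$, $e_B=|E(L_B)|$. A coherent orientation $O$ is a choice of one direction for each edge of $L_A$ and $L_B$ such that for every 2-cell $\{(a,b),(a',b')\}$ either $a\to a'$ and $b\to b'$, or $a'\to a$ and $b'\to b$. $(\Pi,O)$ is no-fold if no vertex has two distinct outgoing edges of the same color or two distinct incoming edges of the same color. An orientable no-fold product structure is one admitting a coherent orientation $O$ with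 $(\Pi,O)$ no-fold; one such $O$ is fixed and everything below is formed from it. Each color $c$ has two signed colors $(c,\mathrm{out}),(c,\mathrm{in})$. The middle link $L_1$ is the simple bipartite graph with parts $A\sqcup B$ and the set of signed colors, where $v$ is adjacent to $(c,\mathrm{out})$ iff $v$ is the tail of some edge of color $c$, and to $(c,\mathrm{in})$ iff $v$ is the head of some edge of color $c$. $\Sigma(v)$ is the set of signed colors adjacent to $v$; $A_s=\{a\in A:s\in\Sigma(a)\}$, $B_s=\{b\in B:s\in\Sigma(b)\}$. Girth is the length of a shortest cycle, $\infty$ for acyclic graphs. A partial linear space is a point-line incidence structure in which any two distinct points lie on at most one common line (equivalently any two distinct lines share at most one point). *)

(* Defs.v *)
From mathcomp Require Import all_boot.
Set Implicit Arguments.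
Unset Strict Implicit.
Unset Printing Implicit Defensive.

Section Graphs.
Variable T : finType.
(* Simple graphs on T are symmetric irreflexive relations on T. *)
Implicit Type e : rel T.

Definition edge_set e : {set {set T}} :=
  [set [set p.1; p.2] | p in [set p : T * T | e p.1 p.2]].

Definition degree e (x : T) : nat := #|[set y | e x y]|.

(* The length of a shortest cycle, with None standing for infinity.  A cycle
   of length n is a ucycle on n >= 3 vertices, so n is at most #|T|; the
   candidate lengths 3, 4, ..., #|T| are listed in increasing order. *)
Definition girth e : option nat :=
  ohead [seq n <- iota 3 (#|T| - 2) | [exists p : n.-tuple T, ucycleb e p]].

Definition is_orientation e (o : rel T) : Prop :=
  (forall x y, o x y -> e x y) /\ (forall x y, e x y -> o x y (+) o y x).
End Graphs.

(* Order on natural numbers extended by infinity (None). *)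
Definition leq_infty (k : nat) (g : option nat) : bool :=
  if g is Some n then k <= n else true.

Lemma girth_geP (T : finType) (e : rel T) (k : nat) :
  leq_infty k (girth e) <->
  (forall p : seq T, 2 < size p -> ucycle e p -> k <= size p).
Proof.
rewrite /girth; set a := fun n => [exists p : n.-tuple T, ucycleb e p].
have aP (p : seq T) : ucycle e p -> a (size p).
  by move=> ep; apply/existsP; exists (in_tuple p).
have sz (p : seq T) : 2 < size p -> ucycle e p -> size p \in iota 3 (#|T| - 2).
  move=> p3 /andP[_ /card_uniqP up]; rewrite mem_iota p3 /=.
  have := max_card (mem p); rewrite up => le_p.
  by rewrite (addSn 2) ltnS subnKC // (leq_trans (ltnW p3)).
have srt : sorted leq [seq n <- iota 3 (#|T| - 2) | a n].
  by apply: (sorted_filter leq_trans); apply: iota_sorted.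
split.
  move=> H p p3 ep.
  have: size p \in [seq n <- iota 3 (#|T| - 2) | a n].
    by rewrite mem_filter aP ?sz.
  case: [seq n <- _ | _] srt H => //= n s srt kn.
  rewrite inE => /predU1P[-> //|ps]; apply: leq_trans kn _.
  by move: (order_path_min leq_trans srt) => /allP/(_ _ ps).
move=> H.
case E: [seq n <- _ | _] => [|n s] //=.
have: n \in [seq n <- iota 3 (#|T| - 2) | a n] by rewrite E mem_head.
rewrite mem_filter mem_iota => /andP[/existsP[p ep] /andP[n3 _]].
by rewrite -(size_tuple p); apply: H => //; rewrite size_tuple.
Qed.

Section IncidenceStructures.
Variables (X Y : finType) (I : X -> Y -> bool).

Definition partial_linear_space : Prop :=
  forall (x x' : X) (y y' : Y),
    x != x' -> I x y -> I x' y -> I x y' -> I x' y' -> y = y'.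

Definition levi_graph : rel (X + Y) := fun u v =>
  match u, v with
  | inl x, inr y | inr y, inl x => I x y
  | _, _ => false
  end.
End IncidenceStructures.

Section ProductStructures.
Variables A B : finType.

Definition product_structure (m n : nat) (P : {set {set A * B}}) : Prop :=
  [/\ #|A| = m, #|B| = n, partition P [set: A * B] &
      forall C p q, C \in P -> p \in C -> q \in C -> p != q ->
        p.1 != q.1 /\ p.2 != q.2].

Definition even_structure (P : {set {set A * B}}) : Prop :=
  forall C, C \in P -> #|C| = 2.

Definition odd_structure (P : {set {set A * B}}) (p0 : A * B) : Prop :=
  [set p0] \in P /\ forall C, C \in P -> C != [set p0] -> #|C| = 2.

(* d = None in the even case; d = Some (a0, b0) in the odd case, where
   {(a0, b0)} is the cell of size 1. *)
Definition even_or_odd (P : {set {set A * B}}) (d : option (A * B)) : Prop :=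
  if d is Some p0 then odd_structure P p0 else even_structure P.

Definition defect (d : option (A * B)) : {set A * B} :=
  if d is Some p0 then [set p0] else set0.
Definition defectA (d : option (A * B)) : {set A} :=
  if d is Some p0 then [set p0.1] else set0.
Definition defectB (d : option (A * B)) : {set B} :=
  if d is Some p0 then [set p0.2] else set0.
Definition delta (d : option (A * B)) : nat := if d is Some _ then 1 else 0.

Section Colors.
Variable P : {set {set A * B}}.

(* Taking a = a' would read the cell of size 1 as a loop. *)
Definition LA : rel A := fun a a' =>
  (a != a') && [exists b, exists b', [set (a, b); (a', b')] \in P].
Definition LB : rel B := fun b b' =>
  (b != b') && [exists a, exists a', [set (a, b); (a', b')] \in P].

Definition edges : {set {set A} + {set B}} :=
  [set inl e | e in edge_set LA] :|: [set inr f | f in edge_set LB].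

Definition cell_link : rel ({set A} + {set B}) := fun u v =>
  [exists p : A * B, exists q : A * B,
    [&& p != q, [set p; q] \in P,
        u == inl [set p.1; q.1] & v == inr [set p.2; q.2]]].

(* The generated equivalence relation is the reflexive transitive closure
   (connect) of the symmetrized generating relation. *)
Definition same_color : rel ({set A} + {set B}) :=
  connect [rel u v | cell_link u v || cell_link v u].

Definition color_classes : {set {set ({set A} + {set B})}} :=
  equivalence_partition same_color edges.

Definition color : finType :=
  {c : {set ({set A} + {set B})} | c \in color_classes}.

(* (c, true) is (c, out) and (c, false) is (c, in). *)
Definition signed_color : finType := (color * bool)%type.
Definition cout (c : color) : signed_color := (c, true).
Definition cin (c : color) : signed_color := (c, false).

Definition xnum (c : color) : nat :=
  #|[set e in edge_set LA | inl e \in val c]|.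
Definition ynum (c : color) : nat :=
  #|[set f in edge_set LB | inr f \in val c]|.

Section Orientation.
(* oA a a' means that the edge {a, a'} of LA is directed a -> a'. *)
Variables (oA : rel A) (oB : rel B).

Definition coherent_orientation : Prop :=
  [/\ is_orientation LA oA, is_orientation LB oB &
      forall a a' b b',
        (a, b) != (a', b') -> [set (a, b); (a', b')] \in P ->
        (oA a a' /\ oB b b') \/ (oA a' a /\ oB b' b)].

(* The directed edges of color c, in LA and LB together. *)
Definition carc (c : color) : rel (A + B) := fun u v =>
  match u, v with
  | inl a, inl a' => oA a a' && (inl [set a; a'] \in val c)
  | inr b, inr b' => oB b b' && (inr [set b; b'] \in val c)
  | _, _ => false
  end.

Definition no_fold : Prop :=
  forall (c : color) (u v w : A + B),
    (carc c u v -> carc c u w -> v = w) /\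
    (carc c v u -> carc c w u -> v = w).

Definition is_tail (v : A + B) (c : color) : bool := [exists w, carc c v w].
Definition is_head (v : A + B) (c : color) : bool := [exists w, carc c w v].

Definition L1_adj (v : A + B) (s : signed_color) : bool :=
  if s.2 then is_tail v s.1 else is_head v s.1.

Definition L1 : rel ((A + B) + signed_color) := fun u v =>
  match u, v with
  | inl x, inr s | inr s, inl x => L1_adj x s
  | _, _ => false
  end.

Definition Sigma (v : A + B) : {set signed_color} :=
  [set s | L1 (inl v) (inr s)].
Definition Apart (s : signed_color) : {set A} := [set a | s \in Sigma (inl a)].
Definition Bpart (s : signed_color) : {set B} := [set b | s \in Sigma (inr b)].

Definition incident (v : A + B) (s : signed_color) : bool :=
  v \in [set inl a | a in Apart s] :|: [set inr b | b in Bpart s].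

Definition rectangle (s : signed_color) : {set A * B} :=
  setX (Apart s) (Bpart s).
End Orientation.
End Colors.
End ProductStructures.

Arguments L1 {A B} P oA oB.
Arguments incident {A B} P oA oB.
Arguments rectangle {A B} P oA oB.
Arguments Apart {A B} P oA oB.
Arguments Bpart {A B} P oA oB.

(* Main.v *)
(* Girth at least 6 means that L_1 has no 4-cycle, i.e. that two distinct signed
   colors share at most one vertex, so that a position of A x B lies in at most
   one rectangle.  Orienting the 2-cell of a position (a, b) gives a signed color
   whose rectangle contains (a, b), whereas coherence and no-fold force the
   defect out of every rectangle.  By no-fold, the edges of a color correspond
   to their tails and to their heads, and the neighbors of a vertex v to Sigma(v).
   The numerical claims are then double counts, of the positions covered by
   rectangles for (i), (iv) and (vi), and of the pairs of points on a line, resp.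
   of lines through a point, for (vii) and (viii). *)

Require Import Defs.
From mathcomp Require Import all_boot.
From mathcomp Require Import zify.

Set Implicit Arguments.
Unset Strict Implicit.
Unset Printing Implicit Defensive.

(** * Girth and pair counts in incidence structures *)

Lemma card_sum_set (X Y : finType) (p : pred (X + Y)) :
  #|[set v | p v]| = #|[set x | p (inl x)]| + #|[set y | p (inr y)]|.
Proof. by rewrite -!sum1dep_card big_sumType. Qed.

Section Incidence.
Variables (X Y : finType) (I : X -> Y -> bool).

(** The forbidden configuration, two points on two common lines, is self-dual, so it can be excluded
    by counting the common points of two lines. *)
Lemma partial_linear_space_dual :
  partial_linear_space I <->
  (forall y y', y != y' -> #|[set x | I x y && I x y']| <= 1).
Proof.
split=> [pls y y' ny | H x x' y y' nx Ixy Ix'y Ixy' Ix'y'].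
  apply/card_le1_eqP => x x' /[!inE] /andP[xy xy'] /andP[x'y x'y'].
  apply/eqP; apply: contraNT ny => nx; apply/eqP.
  by apply: (pls x' x).
apply/eqP; apply: contraNT nx => ny.
by apply/eqP; have /card_le1_eqP := H _ _ ny; apply; rewrite inE ?Ixy ?Ix'y.
Qed.

(** The graph is bipartite, so only length 4 has to be excluded, and a 4-cycle is exactly a pair of
    points on two common lines. *)
Lemma levi_graph_girth6 :
  leq_infty 6 (girth (levi_graph I)) <-> partial_linear_space I.
Proof.
split=> [/girth_geP H x x' y y' nx Ixy Ix'y Ixy' Ix'y' | pls].
  apply/eqP; apply: contraT => ny.
  suff c4 : ucycle (levi_graph I) [:: inl x; inr y; inl x'; inr y'].
    by have /(_ isT) := H _ _ c4.
  rewrite /ucycle /= Ixy Ix'y Ixy' Ix'y' !inE /= !andbT.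
  by rewrite !orbF; apply/andP; split; [apply: contraNneq nx | apply: contraNneq ny] => -[->].
(* For lengths 3, 4 and 5, splitting each vertex by its side refutes all but the alternating
   4-cycles; one case starts at a point, the other at a line. *)
apply/girth_geP => -[|u1 [|u2 [|u3 [|u4 [|u5 [|u6 s]]]]]] //= _;
  case: u1 => v1; case: u2 => v2 //=; case: u3 => v3 //=;
  try (case: u4 => v4 //=); try (case: u5 => v5 //=);
  rewrite /ucycle /= ?andbF //.
- case/and3P=> /and5P[I1 I2 I3 I4 _] nx /andP[ny _].
  have n13 : v1 != v3 by apply: contraNneq nx => ->; rewrite !inE eqxx orbT.
  by case/negP: ny; rewrite !inE (pls _ _ _ _ n13 I1 I2 I4 I3) eqxx orbT.
case/and3P=> /and5P[I1 I2 I3 I4 _] nx /andP[ny _].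
have n24 : v2 != v4 by apply: contraNneq ny => ->; rewrite !inE eqxx orbT.
by case/negP: nx; rewrite !inE (pls _ _ _ _ n24 I1 I4 I2 I3) eqxx orbT.
Qed.

(** Each summand counts the pairs of lines through one point. Two lines meet in at most one point,
    so no pair is counted twice. *)
Lemma sum_bin2_card_le :
  partial_linear_space I -> \sum_x 'C(#|[set y | I x y]|, 2) <= 'C(#|Y|, 2).
Proof.
move=> pls; rewrite -(card_draws Y 2) -sum1dep_card.
pose J x (S : {set Y}) := (S \subset [set y | I x y]) && (#|S| == 2).
have -> : \sum_x 'C(#|[set y | I x y]|, 2) = \sum_x \sum_(S | J x S) 1.
  by apply: eq_bigr => x _; rewrite -cards_draws -sum1dep_card.
rewrite (exchange_big_dep (fun S : {set Y} => #|S| == 2)) /=; last first.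
  by move=> x S _ /andP[].
apply: leq_sum => S S2; rewrite sum1dep_card.
apply/card_le1_eqP => x x'; rewrite !inE => /andP[Sx _] /andP[Sx' _].
have /cards2P[y [y' [ny defS]]] := S2.
apply/eqP; apply: contraNT ny => nx; apply/eqP.
move: Sx Sx'; rewrite defS !subUset !sub1set !inE => /andP[? ?] /andP[? ?].
exact: (pls x' x).
Qed.
End Incidence.

Lemma double_count (X Y : finType) (R : X -> Y -> bool) :
  \sum_x #|[set y | R x y]| = \sum_y #|[set x | R x y]|.
Proof.
under eq_bigr do rewrite -sum1dep_card.
under [RHS]eq_bigr do rewrite -sum1dep_card.
by rewrite (exchange_big_dep predT).
Qed.

(** Uniqueness and existence are packed into one equation of numbers, which can be summed in double
    counts. *)
Lemma card_le1_nat_of_bool (T : finType) (S : {set T}) (b : bool) :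
    {in S &, forall x y, x = y} -> ((exists x, x \in S) <-> b) -> #|S| = b.
Proof.
move=> S1 Sb; apply/eqP; rewrite eqn_leq; apply/andP; split; last first.
  case: b Sb => //= -[_ /(_ isT)[x xS]]; rewrite card_gt0.
  by apply/set0Pn; exists x.
have [S0|[x xS]] := set_0Vmem S; first by rewrite S0 cards0.
have -> : b by apply/Sb; exists x.
by apply/card_le1_eqP => y z ? ?; apply: S1.
Qed.

Lemma eq_set2 (T : finType) (a b a' b' : T) :
  [set a; b] = [set a'; b'] -> (a = a' /\ b = b') \/ (a = b' /\ b = a').
Proof.
move=> E; have := set21 a b; have := set22 a b.
have := set21 a' b'; have := set22 a' b'; rewrite E -{1 2}E.
by do 4![case/set2P=> ?]; subst; auto.
Qed.

(** * Edge-colored oriented graphs without folds, a common model of both horizontal graphs *)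

Section ColoredOrientation.
Variables (T C : finType) (e o : rel T) (E : C -> {set {set T}}).
Hypothesis e_sym : symmetric e.
Hypothesis eo : is_orientation e o.
Hypothesis EP : forall u, #|[set c | u \in E c]| = (u \in edge_set e).
Hypothesis out_inj : forall c x y z,
  o x y -> [set x; y] \in E c -> o x z -> [set x; z] \in E c -> y = z.
Hypothesis in_inj : forall c x y z,
  o y x -> [set y; x] \in E c -> o z x -> [set z; x] \in E c -> y = z.

(** The sign tells whether an arc is followed along or against its direction, so tails and heads are
    treated alike: the start of the dart is the vertex adjacent to [s] in the middle link. *)
Definition dart (s : C * bool) (x y : T) : bool :=
  (if s.2 then o x y else o y x) && ([set x; y] \in E s.1).

Definition dart_ends (s : C * bool) : {set T} := [set x | [exists y, dart s x y]].

Lemma edge_setP x y : reflect (e x y) ([set x; y] \in edge_set e).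
Proof.
apply: (iffP imsetP) => [[[x' y'] /[!inE] /= exy /eq_set2[[-> ->//]|[-> ->]]]|exy].
  by rewrite e_sym.
by exists (x, y); rewrite ?inE.
Qed.

Lemma orientation_asym x y : o x y -> ~~ o y x.
Proof. by case: eo => oe oxor oxy; have := oxor _ _ (oe _ _ oxy); rewrite oxy. Qed.

Lemma color_class_sub c u : u \in E c -> u \in edge_set e.
Proof.
move=> uc; have := EP u; case: (u \in edge_set e) => //= /eqP.
by rewrite cards_eq0 => /eqP/setP/(_ c); rewrite !inE uc.
Qed.

Lemma color_class_inj c c' u : u \in E c -> u \in E c' -> c = c'.
Proof.
move=> uc uc'; have : #|[set c | u \in E c]| <= 1 by rewrite EP leq_b1.
by move/card_le1_eqP; apply; rewrite inE.
Qed.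

Lemma color_class_ex u : u \in edge_set e -> exists c, u \in E c.
Proof.
move=> ue; have : 0 < #|[set c | u \in E c]| by rewrite EP ue.
by rewrite card_gt0 => /set0Pn[c /[!inE]]; exists c.
Qed.

Lemma sum_color_class : \sum_c #|E c| = #|edge_set e|.
Proof.
have -> : \sum_c #|E c| = \sum_c #|[set u | u \in E c]|.
  by apply: eq_bigr => c _; apply: eq_card => u; rewrite inE.
rewrite (double_count (fun c u => u \in E c)).
by rewrite (eq_bigr _ (fun u _ => EP u)) -big_mkcond sum1_card.
Qed.

(** The orientation identifies the edges of a color with its arcs; by no-fold, an arc is determined
    by its tail, and also by its head. *)
Lemma card_dart_ends s : #|dart_ends s| = #|E s.1|.
Proof.
pose arcs := [set p : T * T | o p.1 p.2 && ([set p.1; p.2] \in E s.1)].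
have defE : E s.1 = [set [set p.1; p.2] | p in arcs].
  apply/setP=> u; apply/idP/imsetP=> [uE | [p /[!inE] /andP[_ pE] -> //]].
  have /imsetP[[x y] /[!inE] /= exy defu] := color_class_sub uE.
  have := eo.2 _ _ exy; case oxy: (o x y) => oyx.
    by exists (x, y); rewrite ?inE /= ?oxy -?defu.
  by exists (y, x); rewrite ?inE /= setUC -defu // uE andbT.
have -> : #|E s.1| = #|arcs|.
  rewrite defE card_in_imset // => -[x y] [x' y'] /[!inE] /andP[/= oxy _].
  move=> /andP[oxy' _] /eq_set2[[-> -> //]|[ex ey]].
  by have := orientation_asym oxy; rewrite ex ey oxy'.
case: s @arcs defE => c [] arcs defE /=.
  have -> : dart_ends (c, true) = [set p.1 | p in arcs].
    apply/setP => x; rewrite inE; apply/existsP/imsetP => [[y xy]|[[x' y] + ->]].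
      by exists (x, y); rewrite ?inE.
    by rewrite inE => ?; exists y.
  rewrite card_in_imset // => -[x y] [x' y'] /[!inE] /andP[/= oxy Exy].
  by move=> /andP[oxy' Exy'] ex; rewrite -ex in oxy' Exy' *; rewrite (out_inj oxy Exy oxy').
have -> : dart_ends (c, false) = [set p.2 | p in arcs].
  apply/setP => x; rewrite inE; apply/existsP/imsetP => [[y xy]|[[y x'] + ->]].
    by exists (y, x); rewrite ?inE //= setUC.
  by rewrite inE => yx; exists y; rewrite /dart setUC.
rewrite card_in_imset // => -[x y] [x' y'] /[!inE] /andP[/= oxy Exy].
by move=> /andP[oxy' Exy'] ex; rewrite -ex in oxy' Exy' *; rewrite (in_inj oxy Exy oxy').
Qed.

Lemma card_dart_targets s x : #|[set y | dart s x y]| = (x \in dart_ends s).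
Proof.
apply: card_le1_nat_of_bool; last first.
  rewrite inE; split=> [[y /[!inE] xy]|/existsP[y xy]]; last by exists y; rewrite inE.
  by apply/existsP; exists y.
case: s => c [] y z /[!inE] /andP[/= o1 E1] /andP[/= o2 E2].
  exact: (out_inj o1 E1 o2 E2).
by rewrite ![[set x; _]]setUC in E1 E2; exact: (in_inj o1 E1 o2 E2).
Qed.

(** An edge has exactly one color, and its direction as seen from [x] fixes the sign. *)
Lemma card_dart_colors x y : #|[set s | dart s x y]| = e x y.
Proof.
apply: card_le1_nat_of_bool.
  move=> [c b] [c' b'] /[!inE] /andP[/= o1 E1] /andP[/= o2 E2].
  congr (_, _); first exact: (color_class_inj E1 E2).
  case: b b' o1 o2 => -[] // o1 o2; first by have := orientation_asym o1; rewrite o2.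
  by have := orientation_asym o1; rewrite o2.
split=> [[s /[!inE] /andP[_ /color_class_sub/edge_setP//]]|exy].
have /color_class_ex[c cE] : [set x; y] \in edge_set e by apply/edge_setP.
by exists (c, o x y); rewrite inE /dart cE andbT /=; have := eo.2 _ _ exy; case: (o x y).
Qed.

(** Count the pairs of a signed color [s] and a vertex [y] with [dart s x y]: each [s] ending at [x]
    has one target, and each neighbor [y] is reached by one [s]. *)
Lemma degree_dart_ends x : degree e x = #|[set s | x \in dart_ends s]|.
Proof.
rewrite -[RHS]sum1dep_card big_mkcond /=.
rewrite (eq_bigr _ (fun s _ => esym (card_dart_targets s x))).
rewrite (double_count (fun s y => dart s x y)).
under eq_bigr do rewrite card_dart_colors.
by rewrite -big_mkcond sum1dep_card.
Qed.

End ColoredOrientation.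

(** * Families of rectangles that cover each position outside [D] exactly once *)

Section Rectangles.
Variables (A B S : finType) (As : S -> {set A}) (Bs : S -> {set B}) (D : A -> B -> bool).
Hypothesis rectP : forall a b,
  #|[set s | (a \in As s) && (b \in Bs s)]| = (~~ D a b).

Lemma sum_rect_through b :
  \sum_(s | b \in Bs s) #|As s| + #|[set a | D a b]| = #|A|.
Proof.
have -> : \sum_(s | b \in Bs s) #|As s|
        = \sum_s #|[set a | (a \in As s) && (b \in Bs s)]|.
  rewrite big_mkcond; apply: eq_bigr => s _; case: (b \in Bs s).
    by apply: eq_card => a; rewrite inE andbT.
  by rewrite eq_card0 // => a; rewrite inE andbF.
rewrite (double_count (fun s a => (a \in As s) && (b \in Bs s))).
rewrite (eq_bigr _ (fun a _ => rectP a b)) -big_mkcond sum1_card.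
by rewrite -(cardC [set a | D a b]) addnC; congr (_ + _); apply: eq_card => a; rewrite !inE.
Qed.

(** Count the positions of the strip over [Bs s0]. The rectangle of [s0] fills [#|As s0|] positions
    for each [b]; any other rectangle meets the strip in at most one [b], hence in at most [#|As s|]
    positions; the rest lies in [D]. *)
Lemma rect_complement_le (s0 : S) :
    (forall s, s != s0 -> #|Bs s :&: Bs s0| <= 1) ->
  #|Bs s0| * (#|A| - #|As s0|)
    <= \sum_(s | s != s0) #|As s| + \sum_b #|[set a | D a b]|.
Proof.
move=> H; rewrite mulnBr leq_subLR addnA.
have -> : #|Bs s0| * #|A| = \sum_(b in Bs s0) \sum_(s | b \in Bs s) #|As s|
                          + \sum_(b in Bs s0) #|[set a | D a b]|.
  rewrite -big_split /= -sum_nat_const; apply: eq_bigr => b _.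
  by rewrite sum_rect_through.
apply: leq_add; last by rewrite [leqRHS](bigID (mem (Bs s0))) leq_addr.
(* Regroup the strip by rectangles and set that of [s0] apart. *)
rewrite (exchange_big_dep predT) //= (bigD1 s0) //=; apply: leq_add.
  by rewrite sum_nat_const; rewrite leq_mul2r; apply/orP; right; apply: subset_leq_card;
    apply/subsetP => b; rewrite unfold_in => /andP[].
apply: leq_sum => s ns; rewrite sum_nat_const -[leqRHS]mul1n leq_mul2r.
by apply/orP; right; rewrite (leq_trans _ (H _ ns)) //; apply: subset_leq_card;
  apply/subsetP => b; rewrite unfold_in inE andbC.
Qed.
End Rectangles.

(** * Cells, mates and colors of a product structure *)

Section Cells.
Variables (A B : finType) (P : {set {set A * B}}) (d : option (A * B)).
Hypothesis partP : partition P [set: A * B].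
Hypothesis cellP : forall C p q, C \in P -> p \in C -> q \in C -> p != q ->
  p.1 != q.1 /\ p.2 != q.2.
Hypothesis hd : even_or_odd P d.

Lemma cell_inj C C' p : C \in P -> C' \in P -> p \in C -> p \in C' -> C = C'.
Proof.
case/and3P: partP => _ trivP _ CP C'P pC pC'.
by rewrite -(def_pblock trivP CP pC) -(def_pblock trivP C'P pC').
Qed.

Lemma mate_ex p : p \notin defect d -> exists2 q, p != q & [set p; q] \in P.
Proof.
move=> pD; have /and3P[/eqP covP _ _] := partP.
have : p \in cover P by rewrite covP.
case/bigcupP=> C CP pC.
have /eqP/cards2P[x [y [nxy defC]]] : #|C| = 2.
  case: d hd pD => [p0 [_ oddP] | + _]; last exact.
  by rewrite inE => np0; apply: oddP => //; apply: contraNneq np0 => C0; rewrite C0 inE in pC.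
move: pC CP; rewrite defC => /set2P[->|->] CP; first by exists y.
by exists x; rewrite 1?eq_sym // setUC.
Qed.

(** The notation [[set p; q]] also covers a singleton, when [q = p]; for the cell of the defect this
    is the only possibility. *)
Lemma defect_cell p q : p \in defect d -> [set p; q] \in P -> q = p.
Proof.
case: d hd => [p0 [p0P _]|_] /=; last by rewrite inE.
rewrite inE => /eqP-> pqP; apply/set1P.
by rewrite (cell_inj p0P pqP (set11 p0) (set21 p0 q)) set22.
Qed.

Lemma cell_neq a b a' b' : (a, b) != (a', b') -> [set (a, b); (a', b')] \in P ->
  a != a' /\ b != b'.
Proof. by move=> npq pqP; apply: (cellP pqP (set21 _ _) (set22 _ _) npq). Qed.

Lemma LA_cell a b a' b' :
  (a, b) != (a', b') -> [set (a, b); (a', b')] \in P -> LA P a a'.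
Proof.
move=> npq pqP; rewrite /LA (cell_neq npq pqP).1 /=.
by apply/existsP; exists b; apply/existsP; exists b'.
Qed.

Lemma LB_cell a b a' b' :
  (a, b) != (a', b') -> [set (a, b); (a', b')] \in P -> LB P b b'.
Proof.
move=> npq pqP; rewrite /LB (cell_neq npq pqP).2 /=.
by apply/existsP; exists a; apply/existsP; exists a'.
Qed.

Lemma LA_sym : symmetric (LA P).
Proof.
move=> a a'; rewrite /LA eq_sym; congr (_ && _).
by apply/existsP/existsP => -[b /existsP[b' /=]]; rewrite setUC;
  exists b'; apply/existsP; exists b.
Qed.

Lemma LB_sym : symmetric (LB P).
Proof.
move=> b b'; rewrite /LB eq_sym; congr (_ && _).
by apply/existsP/existsP => -[a /existsP[a' /=]]; rewrite setUC;
  exists a'; apply/existsP; exists a.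
Qed.

Lemma same_color_equiv :
  {in edges P & &, equivalence_rel (same_color P)}.
Proof.
have csym : connect_sym [rel u v | cell_link P u v || cell_link P v u].
  by apply: sym_connect_sym => u v; rewrite /= orbC.
move=> u v w _ _ _; split; first exact: connect0.
by move=> uv; apply: same_connect.
Qed.

Lemma color_classesP : partition (color_classes P) (edges P).
Proof. exact: equivalence_partitionP same_color_equiv. Qed.

Lemma card_colors_of u : #|[set c : color P | u \in val c]| = (u \in edges P).
Proof.
have /and3P[/eqP covC trivC _] := color_classesP.
apply: card_le1_nat_of_bool.
  move=> c c' /[!inE] uc uc'; apply: val_inj.
  by rewrite /= -(def_pblock trivC (valP c) uc) -(def_pblock trivC (valP c') uc').
rewrite -covC; split=> [[c /[!inE] uc]|/bigcupP[C CP uC]].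
  by apply/bigcupP; exists (val c); first exact: valP.
by exists (Sub C CP); rewrite inE SubK.
Qed.

Lemma inl_edges u : (inl u \in edges P) = (u \in edge_set (LA P)).
Proof.
rewrite inE; apply/orP/idP => [[/imsetP[e ? [->]] //|/imsetP[e _ //]]|uE].
by left; apply/imsetP; exists u.
Qed.

Lemma inr_edges u : (inr u \in edges P) = (u \in edge_set (LB P)).
Proof.
rewrite inE; apply/orP/idP => [[/imsetP[e _ //]|/imsetP[e ? [->]] //]|uE].
by right; apply/imsetP; exists u.
Qed.

Lemma color_edges (c : color P) u : u \in val c -> u \in edges P.
Proof.
move=> uc; have /and3P[/eqP<- _ _] := color_classesP.
by apply/bigcupP; exists (val c); first exact: valP.
Qed.

Lemma cell_same_color (c : color P) a b a' b' :
    (a, b) != (a', b') -> [set (a, b); (a', b')] \in P ->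
  (inl [set a; a'] \in val c) = (inr [set b; b'] \in val c).
Proof.
move=> npq pqP.
have uE : inl [set a; a'] \in edges P.
  by rewrite inl_edges; apply/(edge_setP LA_sym)/(LA_cell npq pqP).
have vE : inr [set b; b'] \in edges P.
  by rewrite inr_edges; apply/(edge_setP LB_sym)/(LB_cell npq pqP).
have link : cell_link P (inl [set a; a']) (inr [set b; b']).
  apply/existsP; exists (a, b); apply/existsP; exists (a', b').
  by rewrite npq pqP !eqxx.
(* The color consists of the edges connected to a representative [x], and a path from [x] to one of
   the two edges extends by the link to the other. *)
have /imsetP[x xE ->] := valP c; rewrite [LHS]in_set [RHS]in_set uE vE /=.
apply/idP/idP => xu; apply: connect_trans xu _; apply: connect1 => /=;
  by rewrite link ?orbT.
Qed.

(** A color contains an edge, and any edge comes from a 2-cell, whose two edges share their color.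
    Hence every color occurs on both sides, and no rectangle is empty. *)
Lemma color_has_cell (c : color P) : exists a b a' b',
  [/\ (a, b) != (a', b'), [set (a, b); (a', b')] \in P &
      (inl [set a; a'] \in val c) && (inr [set b; b'] \in val c)].
Proof.
have /and3P[_ _ nC] := color_classesP.
have : val c != set0 by apply: contraNneq nC => <-; apply: valP.
case/set0Pn=> u uc; have := color_edges uc.
case: u uc => u uc.
  rewrite inl_edges => /imsetP[[a a'] /[!inE] /= /andP[na]].
  case/existsP=> b /existsP[b' abP] defu; exists a, b, a', b'.
  have npq : (a, b) != (a', b') by apply: contraNneq na => -[->].
  by split=> //; rewrite -(cell_same_color _ npq abP) andbb -defu.
rewrite inr_edges => /imsetP[[b b'] /[!inE] /= /andP[nb]].
case/existsP=> a /existsP[a' abP] defu; exists a, b, a', b'.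
have npq : (a, b) != (a', b') by apply: contraNneq nb => -[_ ->].
by split=> //; rewrite (cell_same_color _ npq abP) andbb -defu.
Qed.

(** * Signed colors as darts in the two horizontal graphs *)

Section Oriented.
Variables (oA : rel A) (oB : rel B).
Hypothesis hO : coherent_orientation P oA oB.
Hypothesis hNF : no_fold P oA oB.

(** The set counted by [xnum], given a name so that the results on colored orientations apply. *)
Definition colorA (c : color P) : {set {set A}} :=
  [set e in edge_set (LA P) | inl e \in val c].
Definition colorB (c : color P) : {set {set B}} :=
  [set f in edge_set (LB P) | inr f \in val c].

Lemma mem_colorA c e : (e \in colorA c) = (inl e \in val c).
Proof. by rewrite inE andb_idl // => /color_edges; rewrite inl_edges. Qed.

Lemma mem_colorB c f : (f \in colorB c) = (inr f \in val c).
Proof. by rewrite inE andb_idl // => /color_edges; rewrite inr_edges. Qed.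

Lemma card_colorsA e : #|[set c | e \in colorA c]| = (e \in edge_set (LA P)).
Proof.
by rewrite -inl_edges -card_colors_of; apply: eq_card => c; rewrite in_set mem_colorA in_set.
Qed.

Lemma card_colorsB f : #|[set c | f \in colorB c]| = (f \in edge_set (LB P)).
Proof.
by rewrite -inr_edges -card_colors_of; apply: eq_card => c; rewrite in_set mem_colorB in_set.
Qed.

Lemma outA_inj c x y z : oA x y -> [set x; y] \in colorA c ->
  oA x z -> [set x; z] \in colorA c -> y = z.
Proof.
rewrite !mem_colorA => oy cy oz cz.
have [H _] := hNF c (inl x) (inl y) (inl z).
have [//] : inl y = inl z :> A + B by apply: H; rewrite /= ?oy ?oz.
Qed.

Lemma inA_inj c x y z : oA y x -> [set y; x] \in colorA c ->
  oA z x -> [set z; x] \in colorA c -> y = z.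
Proof.
rewrite !mem_colorA => oy cy oz cz.
have [_ H] := hNF c (inl x) (inl y) (inl z).
have [//] : inl y = inl z :> A + B by apply: H; rewrite /= ?oy ?oz.
Qed.

Lemma outB_inj c x y z : oB x y -> [set x; y] \in colorB c ->
  oB x z -> [set x; z] \in colorB c -> y = z.
Proof.
rewrite !mem_colorB => oy cy oz cz.
have [H _] := hNF c (inr x) (inr y) (inr z).
have [//] : inr y = inr z :> A + B by apply: H; rewrite /= ?oy ?oz.
Qed.

Lemma inB_inj c x y z : oB y x -> [set y; x] \in colorB c ->
  oB z x -> [set z; x] \in colorB c -> y = z.
Proof.
rewrite !mem_colorB => oy cy oz cz.
have [_ H] := hNF c (inr x) (inr y) (inr z).
have [//] : inr y = inr z :> A + B by apply: H; rewrite /= ?oy ?oz.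
Qed.

Lemma mem_Apart s a : (a \in Apart P oA oB s) = L1_adj oA oB (inl a) s.
Proof. by rewrite !inE. Qed.

Lemma mem_Bpart s b : (b \in Bpart P oA oB s) = L1_adj oA oB (inr b) s.
Proof. by rewrite !inE. Qed.

Lemma Apart_dart_ends s : Apart P oA oB s = dart_ends oA colorA s.
Proof.
apply/setP=> a; rewrite mem_Apart inE; case: s => c [];
  apply/existsP/existsP=> [[[a'|b] //= /andP[o1 c1]]|[a' /andP[/= o1 c1]]];
  try (by exists a'; apply/andP; rewrite mem_colorA // setUC);
  by exists (inl a'); rewrite /= o1 -mem_colorA // setUC.
Qed.

Lemma Bpart_dart_ends s : Bpart P oA oB s = dart_ends oB colorB s.
Proof.
apply/setP=> b; rewrite mem_Bpart inE; case: s => c [];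
  apply/existsP/existsP=> [[[a|b'] //= /andP[o1 c1]]|[b' /andP[/= o1 c1]]];
  try (by exists b'; apply/andP; rewrite mem_colorB // setUC);
  by exists (inr b'); rewrite /= o1 -mem_colorB // setUC.
Qed.

Lemma card_Apart s : #|Apart P oA oB s| = xnum s.1.
Proof.
case: hO => oAP _ _; rewrite Apart_dart_ends.
exact: (card_dart_ends oAP card_colorsA outA_inj inA_inj).
Qed.

Lemma card_Bpart s : #|Bpart P oA oB s| = ynum s.1.
Proof.
case: hO => _ oBP _; rewrite Bpart_dart_ends.
exact: (card_dart_ends oBP card_colorsB outB_inj inB_inj).
Qed.

Lemma sum_xnum : \sum_(c : color P) xnum c = #|edge_set (LA P)|.
Proof. exact: (sum_color_class card_colorsA). Qed.

Lemma sum_ynum : \sum_(c : color P) ynum c = #|edge_set (LB P)|.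
Proof. exact: (sum_color_class card_colorsB). Qed.

Lemma degree_LA a : degree (LA P) a = #|[set s : signed_color P | L1_adj oA oB (inl a) s]|.
Proof.
case: hO => oAP _ _.
rewrite (degree_dart_ends LA_sym oAP card_colorsA outA_inj inA_inj).
by apply: eq_card => s; rewrite !inE -mem_Apart Apart_dart_ends inE.
Qed.

Lemma degree_LB b : degree (LB P) b = #|[set s : signed_color P | L1_adj oA oB (inr b) s]|.
Proof.
case: hO => _ oBP _.
rewrite (degree_dart_ends LB_sym oBP card_colorsB outB_inj inB_inj).
by apply: eq_card => s; rewrite !inE -mem_Bpart Bpart_dart_ends inE.
Qed.

(** By coherence both edges of a cell point the same way, so a single sign serves both. This puts
    the position [(a, b)] into the rectangle of [(c, sg)]. *)
Lemma cell_darts (c : color P) a b a' b' :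
    (a, b) != (a', b') -> [set (a, b); (a', b')] \in P -> inl [set a; a'] \in val c ->
  exists sg : bool, dart oA colorA (c, sg) a a' /\ dart oB colorB (c, sg) b b'.
Proof.
move=> npq pqP ac; have bc := ac; rewrite (cell_same_color c npq pqP) in bc.
case: hO => _ _ /(_ _ _ _ _ npq pqP)[] [o1 o2]; [exists true|exists false];
  by rewrite /dart /= o1 o2 mem_colorA mem_colorB.
Qed.

Lemma dart_Apart s a a' : dart oA colorA s a a' -> a \in Apart P oA oB s.
Proof. by move=> h; rewrite Apart_dart_ends inE; apply/existsP; exists a'. Qed.

Lemma dart_Bpart s b b' : dart oB colorB s b b' -> b \in Bpart P oA oB s.
Proof. by move=> h; rewrite Bpart_dart_ends inE; apply/existsP; exists b'. Qed.

Lemma cell_color a b a' b' :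
    (a, b) != (a', b') -> [set (a, b); (a', b')] \in P ->
  exists c : color P, inl [set a; a'] \in val c.
Proof.
move=> npq pqP; have : 0 < #|[set c : color P | inl [set a; a'] \in val c]|.
  rewrite card_colors_of inl_edges.
  by have /(edge_setP LA_sym)-> := LA_cell npq pqP.
by rewrite card_gt0 => /set0Pn[c /[!inE]]; exists c.
Qed.

Lemma Apart_gt0 s : 0 < #|Apart P oA oB s|.
Proof.
have [a [b [a' [b' [_ _ /andP[ac _]]]]]] := color_has_cell s.1.
rewrite card_Apart card_gt0; apply/set0Pn; exists [set a; a'].
by rewrite -/(colorA _) mem_colorA.
Qed.

Lemma Bpart_gt0 s : 0 < #|Bpart P oA oB s|.
Proof.
have [a [b [a' [b' [_ _ /andP[_ bc]]]]]] := color_has_cell s.1.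
rewrite card_Bpart card_gt0; apply/set0Pn; exists [set b; b'].
by rewrite -/(colorB _) mem_colorB.
Qed.

(** * The rectangles partition the complement of the defect *)

Section SmallIntersections.
Hypothesis small_meet : forall s t, s != t ->
  #|Apart P oA oB s :&: Apart P oA oB t| + #|Bpart P oA oB s :&: Bpart P oA oB t| <= 1.

(** A position common to two rectangles would add 1 to each of the two intersection sizes, giving 2
    in total. *)
Lemma rectangle_unique a b s t :
    a \in Apart P oA oB s -> b \in Bpart P oA oB s ->
    a \in Apart P oA oB t -> b \in Bpart P oA oB t -> s = t.
Proof.
move=> As Bs At Bt; apply/eqP; apply: contraT => /small_meet.
rewrite leqNgt => /negP[]; apply: (@leq_add 1 1); rewrite card_gt0.
  by apply/set0Pn; exists a; rewrite inE As.
by apply/set0Pn; exists b; rewrite inE Bs.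
Qed.

(* If the defect (a0, b0) lay in the rectangle of (c, out), follow the arcs of
   color c to (a1, b1).  This position has a mate, and the color and sign of its
   cell must be (c, in); hence by no-fold the mate would be (a0, b0). *)
Lemma defect_notin_rectangle a b s :
  a \in Apart P oA oB s -> b \in Bpart P oA oB s -> (a, b) \notin defect d.
Proof.
rewrite Apart_dart_ends Bpart_dart_ends !inE.
move=> /existsP[a1 da] /existsP[b1 db]; apply/negP => abD.
(* Reversing the sign reverses the darts, so [t] leads from [(a1, b1)] back to [(a, b)]. *)
pose t := (s.1, ~~ s.2).
have flipA x y : dart oA colorA t x y = dart oA colorA s y x.
  by rewrite /dart /t; case: s {da db t} => c []; rewrite /= setUC.
have flipB x y : dart oB colorB t x y = dart oB colorB s y x.
  by rewrite /dart /t; case: s {da db t flipA} => c []; rewrite /= setUC.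
have [oAP _ _] := hO.
have na1 : a1 != a.
  apply: contraTneq da => ->; rewrite /dart negb_and.
  suff -> : oA a a = false by case: s.2.
  by apply/negP => oaa; have := orientation_asym oAP oaa; rewrite oaa.
have a1b1D : (a1, b1) \notin defect d.
  move: abD; rewrite /defect; case: (d) => [p0|]; rewrite !inE // => /eqP<-.
  by apply: contraNneq na1 => -[->].
have [[a2 b2] npq pqP] := mate_ex a1b1D.
have [c ac] := cell_color npq pqP.
have [sg [da1 db1]] := cell_darts npq pqP ac.
have da' := da; have db' := db; rewrite -flipA in da'; rewrite -flipB in db'.
have est : (c, sg) = t.
  exact: rectangle_unique (dart_Apart da1) (dart_Bpart db1) (dart_Apart da') (dart_Bpart db').
rewrite est in da1 db1.
have ea : a2 = a.
  have := card_dart_targets outA_inj inA_inj t a1 => H.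
  have /card_le1_eqP : #|[set y | dart oA colorA t a1 y]| <= 1 by rewrite H leq_b1.
  by apply; rewrite inE.
have eb : b2 = b.
  have := card_dart_targets outB_inj inB_inj t b1 => H.
  have /card_le1_eqP : #|[set y | dart oB colorB t b1 y]| <= 1 by rewrite H leq_b1.
  by apply; rewrite inE.
rewrite ea eb setUC in pqP.
by have [e1 _] := defect_cell abD pqP; rewrite e1 eqxx in na1.
Qed.

(** Small intersections give uniqueness; the cell joining a position to its mate gives existence.
    The form is that of the covering hypothesis [rectP]. *)
Lemma card_rectangles_through a b :
  #|[set s : signed_color P | (a \in Apart P oA oB s) && (b \in Bpart P oA oB s)]|
    = ((a, b) \notin defect d).
Proof.
apply: card_le1_nat_of_bool.
  by move=> s t /[!inE] /andP[? ?] /andP[? ?]; apply: (@rectangle_unique a b); rewrite ?inE.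
split=> [[s]|abD]; first by rewrite inE => /andP[]; apply: defect_notin_rectangle.
have [[a' b'] npq pqP] := mate_ex abD.
have [c ac] := cell_color npq pqP; have [sg [da db]] := cell_darts npq pqP ac.
by exists (c, sg); rewrite inE (dart_Apart da) (dart_Bpart db).
Qed.

Lemma rectangle_partition :
  injective (rectangle P oA oB) /\
  partition [set rectangle P oA oB s | s : signed_color P] (~: defect d).
Proof.
have ne s : exists p, p \in rectangle P oA oB s.
  have := Apart_gt0 s; have := Bpart_gt0 s; rewrite !card_gt0 => /set0Pn[b bs] /set0Pn[a as_].
  by exists (a, b); rewrite in_setX as_.
have uniq s t p : p \in rectangle P oA oB s -> p \in rectangle P oA oB t -> s = t.
  by case: p => a b; rewrite !in_setX => /andP[? ?] /andP[? ?]; apply: (@rectangle_unique a b).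
split=> [s t est|]; first by have [p ps] := ne s; apply: (uniq s t p); rewrite -?est.
apply/and3P; split.
- apply/eqP/setP=> -[a b]; rewrite !inE; apply/bigcupP/idP => [[_ /imsetP[s _ ->]]|abD].
    by rewrite in_setX => /andP[]; apply: defect_notin_rectangle.
  have : 0 < #|[set s : signed_color P | (a \in Apart P oA oB s) && (b \in Bpart P oA oB s)]|.
    by rewrite card_rectangles_through abD.
  rewrite card_gt0 => /set0Pn[s]; rewrite inE => abs.
  by exists (rectangle P oA oB s); [apply: imset_f | rewrite in_setX].
- apply/trivIsetP => _ _ /imsetP[s _ ->] /imsetP[t _ ->] nst.
  rewrite -setI_eq0; apply/set0Pn => -[p /setIP[ps pt]].
  by rewrite (uniq s t p) ?eqxx in nst.
by apply/imsetP => -[s _ e0]; have [p] := ne s; rewrite -e0 inE.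
Qed.

End SmallIntersections.
End Oriented.
End Cells.

(** * Passage to the middle link and the numerical claims *)

Lemma card_meet (A B : finType) (P : {set {set A * B}}) (oA : rel A) (oB : rel B)
    (s t : signed_color P) :
  #|Apart P oA oB s :&: Apart P oA oB t| + #|Bpart P oA oB s :&: Bpart P oA oB t|
    = #|[set v | L1_adj oA oB v s && L1_adj oA oB v t]|.
Proof.
by rewrite card_sum_set; congr (_ + _); apply: eq_card => v; rewrite !inE.
Qed.

Lemma incidentE (A B : finType) (P : {set {set A * B}}) (oA : rel A) (oB : rel B)
    (v : A + B) (s : signed_color P) :
  incident P oA oB v s = L1_adj oA oB v s.
Proof.
rewrite /incident inE; apply/orP/idP.
  by case=> /imsetP[x xs ->]; [rewrite -mem_Apart | rewrite -mem_Bpart].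
case: v => x xs; [left | right]; apply/imsetP; exists x => //.
  by rewrite mem_Apart.
by rewrite mem_Bpart.
Qed.

(** The factor 2 comes from the two signs of a color. *)
Lemma sum_bool (C : finType) (F : C * bool -> nat) (G : C -> nat) :
  (forall s, F s = G s.1) -> \sum_s F s = 2 * \sum_c G c.
Proof.
move=> FG; rewrite (eq_bigr _ (fun s _ => FG s)) -(pair_big predT predT (fun c _ => G c)) /=.
by rewrite big_distrr; apply: eq_bigr => c _; rewrite sum_nat_const card_bool.
Qed.

Theorem mainTheorem2 (A B : finType) (m n : nat) (P : {set {set A * B}})
    (d : option (A * B)) (oA : rel A) (oB : rel B)
    (hP : product_structure m n P) (hd : even_or_odd P d)
    (hm : 2 <= m) (hn : 2 <= n)
    (hO : coherent_orientation P oA oB) (hNF : no_fold P oA oB) :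
  (leq_infty 6 (girth (L1 P oA oB)) <->
     (forall s t : signed_color P, s != t ->
        #|Apart P oA oB s :&: Apart P oA oB t|
          + #|Bpart P oA oB s :&: Bpart P oA oB t| <= 1)) /\
  (leq_infty 6 (girth (L1 P oA oB)) ->
     (* Levi graph of a partial linear space *)
     (partial_linear_space (incident P oA oB) /\
      L1 P oA oB =2 levi_graph (incident P oA oB)) /\
     (* the indexed family of rectangles partitions the complement of D *)
     (injective (rectangle P oA oB) /\
      partition [set rectangle P oA oB s | s : signed_color P] (~: defect d)) /\
     (* (i) *)
     ((forall a : A, \sum_(s in Sigma P oA oB (inl a)) #|Bpart P oA oB s|
                     = n - (a \in defectA d)) /\
      (forall b : B, \sum_(s in Sigma P oA oB (inr b)) #|Apart P oA oB s|
                     = m - (b \in defectB d))) /\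
     (* (ii) *)
     (forall s t : signed_color P, s != t ->
        #|Apart P oA oB s :&: Apart P oA oB t|
          + #|Bpart P oA oB s :&: Bpart P oA oB t| <= 1) /\
     (* (iii) *)
     (forall c : color P,
        (#|Apart P oA oB (cout c)| = xnum c /\ #|Apart P oA oB (cin c)| = xnum c) /\
        (#|Bpart P oA oB (cout c)| = ynum c /\ #|Bpart P oA oB (cin c)| = ynum c)) /\
     (* (iv) *)
     (\sum_(s : signed_color P) #|Apart P oA oB s| * #|Bpart P oA oB s|
        = m * n - delta d /\
      2 * (\sum_(c : color P) xnum c * ynum c) = m * n - delta d) /\
     (* (v) *)
     (forall c : color P,
        xnum c <= (m + 1) %/ 2 /\ ynum c <= (n + 1) %/ 2) /\
     (* (vi); no subtraction is truncated, since a color has at most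
        min(m, e_A) edges in LA and at most min(n, e_B) edges in LB *)
     (forall c : color P,
        ynum c * (m - xnum c) <= 2 * #|edge_set (LA P)| - xnum c + delta d /\
        xnum c * (n - ynum c) <= 2 * #|edge_set (LB P)| - ynum c + delta d) /\
     (* (vii) *)
     (\sum_(c : color P) xnum c * (xnum c - 1) <= 'C(m, 2) /\
      \sum_(c : color P) ynum c * (ynum c - 1) <= 'C(n, 2)) /\
     (* (viii) *)
     (\sum_(a : A) 'C(degree (LA P) a, 2) + \sum_(b : B) 'C(degree (LB P) b, 2)
        <= 'C(#|signed_color P|, 2))).
Proof.
have [cardA cardB partP cellP] := hP.
set As := Apart P oA oB; set Bs := Bpart P oA oB.
have girthE : leq_infty 6 (girth (L1 P oA oB)) <->
    partial_linear_space (@L1_adj _ _ P oA oB).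
  exact: levi_graph_girth6.
have plsE : partial_linear_space (@L1_adj _ _ P oA oB) <->
    forall s t, s != t -> #|As s :&: As t| + #|Bs s :&: Bs t| <= 1.
  split=> [/partial_linear_space_dual|] H; first by move=> s t /H; rewrite card_meet.
  by apply/partial_linear_space_dual => s t /H; rewrite card_meet.
split; first by split=> [/girthE/plsE | /plsE/girthE].
move=> /girthE pls; have small := plsE.1 pls.
have xP s : #|As s| = xnum s.1 by exact: card_Apart.
have yP s : #|Bs s| = ynum s.1 by exact: card_Bpart.
have throughP a b := card_rectangles_through partP cellP hd hO hNF small a b.
(* The transposed covering property, for using the rectangle counts with [A] and [B] exchanged. *)
have throughP' b a : #|[set s | (b \in Bs s) && (a \in As s)]| = ((a, b) \notin defect d).
  by rewrite -throughP; apply: eq_card => s; rewrite !inE andbC.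
have smallA s t : s != t -> #|As s :&: As t| <= 1.
  by move/small; apply: leq_trans; apply: leq_addr.
have smallB s t : s != t -> #|Bs s :&: Bs t| <= 1.
  by move/small; apply: leq_trans; apply: leq_addl.
have defA a : #|[set b | (a, b) \in defect d]| = (a \in defectA d).
  apply: card_le1_nat_of_bool; rewrite /defect /defectA; case: (d) => [[a0 b0]|].
  - by move=> b b' /[!inE] /eqP[_ ->] /eqP[_ ->].
  - by move=> b b'; rewrite !inE.
  - rewrite inE; split=> [[b /[!inE] /eqP[-> _]] //|/eqP->].
    by exists b0; rewrite !inE.
  - by rewrite inE; split=> // -[b]; rewrite !inE.
have defB b : #|[set a | (a, b) \in defect d]| = (b \in defectB d).
  apply: card_le1_nat_of_bool; rewrite /defect /defectB; case: (d) => [[a0 b0]|].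
  - by move=> a a' /[!inE] /eqP[-> _] /eqP[-> _].
  - by move=> a a'; rewrite !inE.
  - rewrite inE; split=> [[a /[!inE] /eqP[_ ->]] //|/eqP->].
    by exists a0; rewrite !inE.
  - by rewrite inE; split=> // -[a]; rewrite !inE.
have deltaA : \sum_a #|[set b | (a, b) \in defect d]| = delta d.
  rewrite (eq_bigr _ (fun a _ => defA a)) -big_mkcond sum1_card.
  by rewrite /defectA /delta; case: (d) => [p|]; rewrite ?cards1 ?cards0.
have deltaB : \sum_b #|[set a | (a, b) \in defect d]| = delta d.
  rewrite (eq_bigr _ (fun a _ => defB a)) -big_mkcond sum1_card.
  by rewrite /defectB /delta; case: (d) => [p|]; rewrite ?cards1 ?cards0.
have cardD : #|defect d| = delta d.
  by rewrite /defect /delta; case: (d) => [p|]; rewrite ?cards1 ?cards0.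
have sumA : \sum_s #|As s| = 2 * #|edge_set (LA P)|.
  by rewrite -sum_xnum; apply: sum_bool.
have sumB : \sum_s #|Bs s| = 2 * #|edge_set (LB P)|.
  by rewrite -sum_ynum; apply: sum_bool.
have [rinj rpart] := rectangle_partition partP cellP hd hO hNF small.
(* The complement of the defect is partitioned by the rectangles; injectivity turns the sum over
   rectangles into one over signed colors. *)
have area : \sum_s #|As s| * #|Bs s| = m * n - delta d.
  rewrite -cardA -cardB -card_prod -cardD -cardsT.
  rewrite -cardsDS ?subsetT // setTD (card_partition rpart) big_imset /=; last exact: in2W.
  by apply: eq_bigr => s _; rewrite cardsX.
split; [split|]; last split; last split; last split; last split; last split;
  last split; last split; last split.
- by move=> v w s t nvw; rewrite !incidentE; apply: pls.
- by case=> [u|s] [v|t] //=; rewrite incidentE.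
- by split.
- split=> [a|b].
    have := sum_rect_through throughP' a; rewrite defA cardB => <-.
    by rewrite addnK; apply: eq_bigl => s; rewrite !inE.
  have := sum_rect_through throughP b; rewrite defB cardA => <-.
  by rewrite addnK; apply: eq_bigl => s; rewrite !inE.
- exact: small.
- by move=> c; rewrite !xP !yP.
- split=> //; rewrite -area; apply/esym/(sum_bool (F := fun s => _ * _)) => s.
  by rewrite xP yP.
(* The tails and the heads of color [c] share at most one vertex on each side, so
   [2 * xnum c - 1 <= m], and likewise for [n]. *)
- move=> c; have nc : cout c != cin c by apply/eqP => -[].
  have := smallA _ _ nc; have := smallB _ _ nc.
  have := cardsUI (As (cout c)) (As (cin c)); have := cardsUI (Bs (cout c)) (Bs (cin c)).
  rewrite !xP !yP /= => eB eA.
  have uA : #|As (cout c) :|: As (cin c)| <= m by rewrite -cardA max_card.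
  have uB : #|Bs (cout c) :|: Bs (cin c)| <= n by rewrite -cardB max_card.
  by move=> iB iA; rewrite !leq_divRL //; split; lia.
(* Apply the strip count to [cout c]; deleting its term from the sum over all signed colors accounts
   for the subtracted [xnum c] or [ynum c]. *)
- move=> c; rewrite -sumA -sumB.
  have hA := rect_complement_le throughP (s0 := cout c) (fun s => smallB _ _).
  have hB := rect_complement_le throughP' (s0 := cout c) (fun s => smallA _ _).
  rewrite deltaB cardA in hA; rewrite deltaA cardB in hB.
  rewrite (bigD1 (cout c)) //= [in X in _ /\ X](bigD1 (cout c)) //=.
  by move: hA hB; rewrite !xP !yP /= !addKn.
(* The product [k * (k - 1)] is twice a binomial, one for each sign, so the sum counts pairs of
   vertices within the parts of the signed colors. *)
- have binE k : k * (k - 1) = 2 * 'C(k, 2) by rewrite -mul_bin_diag bin1 subn1.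
  have dbl (F : color P -> nat) (Xs : signed_color P -> nat) :
      (forall s, Xs s = F s.1) -> \sum_c F c * (F c - 1) = \sum_s 'C(Xs s, 2).
    move=> XF; rewrite (sum_bool (G := fun c => 'C(F c, 2))) => [|s]; last by rewrite XF.
    by rewrite big_distrr; apply: eq_bigr => c _; rewrite binE.
  rewrite (dbl _ _ xP) (dbl _ _ yP) -cardA -cardB; split.
    (* Here the roles are exchanged: signed colors act as points and vertices as lines, so that
       pairs of vertices are counted. *)
    have plsA : partial_linear_space (fun s a => a \in As s).
      move=> s t a a' nst sa ta sa' ta'.
      by have /card_le1_eqP := smallA _ _ nst; apply; rewrite inE ?sa ?sa'.
    apply: leq_trans (sum_bin2_card_le plsA); apply: leq_sum => s _.
    by rewrite cardsE.
  have plsB : partial_linear_space (fun s b => b \in Bs s).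
    move=> s t b b' nst sb tb sb' tb'.
    by have /card_le1_eqP := smallB _ _ nst; apply; rewrite inE ?sb ?sb'.
  apply: leq_trans (sum_bin2_card_le plsB); apply: leq_sum => s _.
  by rewrite cardsE.
(* Now vertices are the points; the degree of a vertex is the number of signed colors through it. *)
have := sum_bin2_card_le pls; rewrite big_sumType /=; apply: leq_trans.
by apply: leq_add; apply: leq_sum => v _; rewrite ?(degree_LA hO hNF) ?(degree_LB hO hNF).
Qed.
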